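(* Modified Algorithm 3 is a factor-$2$ approximation algorithm for $1|(p_j,p_j,b_j)|\sum C_j$. That is, Modified Algorithm 3 runs in polynomial time, and for every instance with $a_j=L_j=p_j$ for all jobs $j$ and arbitrary $b_j$, it outputs a feasible schedule whose sum of completion times is at most $2$ times the minimum sum of completion times over all feasible schedules.
   Context: Coupled task scheduling on a single machine: each job $j\in\{1,\dots,n\}$ has a first task of processing time $a_j>0$, a second task of processing time $b_j>0$, and a delay time $L_j\ge 0$. A feasible schedule assigns a starting time $S_j\ge 0$ to each job $j$; the first task occupies $[S_j,S_j+a_j]$, the second task occupies $[S_j+a_j+L_j,\,S_j+a_j+L_j+b_j]$ (the delay is exact, no preemption), and no two of the $2n$ tasks overlap (their intervals have disjoint interiors). Other tasks may be processed during the delay of a job. The completion time of $j$ is $C_j=S_j+a_j+L_j+b_j$, and the objective is to minimize $\sum_{j=1}^n C_j$. Modified Algorithm 3. Input: an instance with $a_j=L_j=p_j$ for all $j$. Step 1: sort the jobs in non-decreasing order of $p_j+b_j$. Step 2: in this order, schedule the first task of each job right after the second task of the previously scheduled job has completed (the first job starting at time $0$), and its second task according to the delay time. *)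

(* Defs.v *)
From HB Require Import structures.
From mathcomp Require Import all_boot all_order all_algebra.
From mathcomp Require Import all_classical all_reals all_analysis.

Set Implicit Arguments.
Unset Strict Implicit.
Unset Printing Implicit Defensive.

Import Order.TTheory GRing.Theory Num.Theory.
Import numFieldNormedType.Exports.

Local Open Scope classical_set_scope.
Local Open Scope ring_scope.

(** * Coupled task scheduling on a single machine *)

Record instance (K : realFieldType) (n : nat) := Instance {
  first_time : 'I_n -> K;    (* a_j *)
  delay_time : 'I_n -> K;    (* L_j *)
  second_time : 'I_n -> K }. (* b_j *)

Definition valid (K : realFieldType) (n : nat) (I : instance K n) : Prop :=
  forall j, [/\ 0 < first_time I j, 0 <= delay_time I j & 0 < second_time I j].

(* The class (p_j, p_j, b_j), with p_j the common value of a_j and L_j. *)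
Definition delay_eq_first (K : realFieldType) (n : nat) (I : instance K n) :
    Prop :=
  forall j, delay_time I j = first_time I j.

Definition map_instance (K K' : realFieldType) (f : K -> K') (n : nat)
    (I : instance K n) : instance K' n :=
  Instance (f \o first_time I) (f \o delay_time I) (f \o second_time I).

(* A schedule S : 'I_n -> K gives the starting time of every job. *)

Definition completion (K : realFieldType) (n : nat) (I : instance K n)
    (S : 'I_n -> K) (j : 'I_n) : K :=
  S j + first_time I j + delay_time I j + second_time I j.

Definition total_completion (K : realFieldType) (n : nat) (I : instance K n)
    (S : 'I_n -> K) : K :=
  \sum_j completion I S j.

(* The 2n tasks are the pairs (j, k), with k = false for the first task of j
   and k = true for the second one. *)
Definition task_interval (R : realType) (n : nat) (I : instance R n)
    (S : 'I_n -> R) (t : 'I_n * bool) : set R :=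
  let: (j, second) := t in
  let s2 := S j + first_time I j + delay_time I j in
  if second then [set` `[s2, s2 + second_time I j]]
  else [set` `[S j, S j + first_time I j]].

Definition feasible (R : realType) (n : nat) (I : instance R n)
    (S : 'I_n -> R) : Prop :=
  (forall j, 0 <= S j) /\
  trivIset [set: 'I_n * bool] (fun t => interior (task_interval I S t)).

Definition optimal (R : realType) (n : nat) (I : instance R n)
    (S : 'I_n -> R) : Prop :=
  feasible I S /\
  forall S', feasible I S' -> total_completion I S <= total_completion I S'.

(** * Modified Algorithm 3 *)

Fixpoint back_to_back (K : realFieldType) (n : nat) (I : instance K n)
    (S : 'I_n -> K) (t : K) (s : seq 'I_n) : Prop :=
  if s is j :: s' then S j = t /\ back_to_back I S (completion I S j) s'
  else True.

(* S is an output of the algorithm on I.  This is a relation because the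
   sorting step may break ties arbitrarily. *)
Definition modified_algorithm_3 (K : realFieldType) (n : nat)
    (I : instance K n) (S : 'I_n -> K) : Prop :=
  exists s : seq 'I_n,
    [/\ perm_eq s (enum 'I_n),
        sorted (fun i j => first_time I i + second_time I i <=
                           first_time I j + second_time I j) s
      & back_to_back I S 0 s].

(** * Machine model

   A random access machine, presented as a while language.  It has finitely
   many index registers, which hold natural numbers, and finitely many arrays
   of numbers of K, addressed through index registers; the data can only be
   copied, added and compared.  The cost of an instruction is 1 plus the bit
   lengths of the indices plus the weights w of the data that it reads.
   - With w = 0 an operation on data has unit cost, as in the real RAM model,
     up to the bit lengths of the indices.
   - With K = rat and w the bit size, this is the logarithmic cost criterion,
     which is polynomially related to the running time of Turing machines:
     rationals in lowest terms are copied, added and compared in time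
     polynomial in their bit size. *)

Inductive cmd : Type :=
| Skip
| IConst (x k : nat)                   (* x := k *)
| ICopy (x y : nat)                    (* x := y *)
| IAdd (x y z : nat)                   (* x := y + z *)
| DZero (A x : nat)                    (* A[x] := 0 *)
| DCopy (A x B y : nat)                (* A[x] := B[y] *)
| DAdd (A x B y C z : nat)             (* A[x] := B[y] + C[z] *)
| Seq (c1 c2 : cmd)
| IfI (x y : nat) (c1 c2 : cmd)        (* if x < y then c1 else c2 *)
| IfD (A x B y : nat) (c1 c2 : cmd)    (* if A[x] <= B[y] then c1 else c2 *)
| While (x y : nat) (c : cmd).         (* while x < y do c *)

Record state (K : realFieldType) := State {
  reg : nat -> nat;
  arr : nat -> nat -> K }.

Definition set_reg (K : realFieldType) (st : state K) (x v : nat) : state K :=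
  State (fun y => if y == x then v else reg st y) (arr st).

(* A[x] := v, where the index is the content of the register x. *)
Definition set_arr (K : realFieldType) (st : state K) (A x : nat) (v : K) :
    state K :=
  State (reg st)
    (fun B i => if (B == A) && (i == reg st x) then v else arr st B i).

Definition get_arr (K : realFieldType) (st : state K) (A x : nat) : K :=
  arr st A (reg st x).

Definition bitlen (m : nat) : nat := (trunc_log 2 m).+1.

(* exec w c st T st' : started in st, the command c halts in st' at cost T. *)
Inductive exec (K : realFieldType) (w : K -> nat) :
    cmd -> state K -> nat -> state K -> Prop :=
| exec_Skip st : exec w Skip st 1 st
| exec_IConst st x k :
    exec w (IConst x k) st (1 + bitlen k)%N (set_reg st x k)
| exec_ICopy st x y :
    exec w (ICopy x y) st (1 + bitlen (reg st y))%N (set_reg st x (reg st y))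
| exec_IAdd st x y z :
    exec w (IAdd x y z) st (1 + bitlen (reg st y) + bitlen (reg st z))%N
      (set_reg st x (reg st y + reg st z)%N)
| exec_DZero st A x :
    exec w (DZero A x) st (1 + bitlen (reg st x))%N (set_arr st A x 0)
| exec_DCopy st A x B y :
    exec w (DCopy A x B y) st
      (1 + bitlen (reg st x) + bitlen (reg st y) + w (get_arr st B y))%N
      (set_arr st A x (get_arr st B y))
| exec_DAdd st A x B y C z :
    exec w (DAdd A x B y C z) st
      (1 + bitlen (reg st x) + bitlen (reg st y) + bitlen (reg st z)
         + w (get_arr st B y) + w (get_arr st C z))%N
      (set_arr st A x (get_arr st B y + get_arr st C z))
| exec_Seq c1 c2 st1 st2 st3 T1 T2 :
    exec w c1 st1 T1 st2 -> exec w c2 st2 T2 st3 ->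
    exec w (Seq c1 c2) st1 (T1 + T2)%N st3
| exec_IfI x y c1 c2 st T st' :
    exec w (if (reg st x < reg st y)%N then c1 else c2) st T st' ->
    exec w (IfI x y c1 c2) st
      (1 + bitlen (reg st x) + bitlen (reg st y) + T)%N st'
| exec_IfD A x B y c1 c2 st T st' :
    exec w (if get_arr st A x <= get_arr st B y then c1 else c2) st T st' ->
    exec w (IfD A x B y c1 c2) st
      (1 + bitlen (reg st x) + bitlen (reg st y)
         + w (get_arr st A x) + w (get_arr st B y) + T)%N st'
| exec_While_stop x y c st :
    (reg st y <= reg st x)%N ->
    exec w (While x y c) st (1 + bitlen (reg st x) + bitlen (reg st y))%N st
| exec_While_step x y c st1 st2 st3 T1 T2 :
    (reg st1 x < reg st1 y)%N ->
    exec w c st1 T1 st2 -> exec w (While x y c) st2 T2 st3 ->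
    exec w (While x y c) st1
      (1 + bitlen (reg st1 x) + bitlen (reg st1 y) + T1 + T2)%N st3.

Definition input_array (K : realFieldType) (n : nat) (f : 'I_n -> K)
    (i : nat) : K :=
  if insub i is Some j then f j else 0.

(* Register 0 contains n and arrays 0, 1, 2 contain the a_j, L_j, b_j.  All
   other registers and cells are zero. *)
Definition input_state (K : realFieldType) (n : nat) (I : instance K n) :
    state K :=
  State (fun x => if x == 0 then n else 0)%N
    (fun A => match A with
              | 0%N => input_array (first_time I)
              | 1%N => input_array (delay_time I)
              | 2%N => input_array (second_time I)
              | _ => fun=> 0
              end).

(* Started on I, the program c halts at cost T, with the starting times S in
   array 3. *)
Definition computes (K : realFieldType) (w : K -> nat) (c : cmd) (n : nat)
    (I : instance K n) (S : 'I_n -> K) (T : nat) : Prop :=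
  exists2 st, exec w c (input_state I) T st & forall j : 'I_n, S j = arr st 3 j.

Definition unit_weight (K : realFieldType) (x : K) : nat := 0%N.

Definition bitsize (q : rat) : nat :=
  (bitlen `|numq q| + bitlen `|denq q|)%N.

Definition input_size (n : nat) (I : instance rat n) : nat :=
  (\sum_j (bitsize (first_time I j) + bitsize (delay_time I j)
           + bitsize (second_time I j)))%N.

(* Main.v *)
(* In a feasible schedule the machine has processed, by the completion time of
   job j, both tasks of every job completed no later than j, so C_j is at least
   the sum of p_i + b_i over these jobs.  Summed over j, this bound is smallest
   for the order of non-decreasing p_j + b_j, as one sees by comparing the
   contributions of each pair of jobs.  In that order the algorithm completes j
   at the sum of 2 p_i + b_i <= 2 (p_i + b_i) over the jobs up to j.
   A minimum is attained because two tasks do not overlap iff one ends before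
   the other starts, which is a closed condition on the starting times, and
   these may be confined to a compact box.
   The program does not sort: the starting time of j is the sum of the durations
   of the jobs that precede j in the lexicographic order of (p + b, index), and
   a double loop computes these sums. *)

Require Import Defs.
From HB Require Import structures.
From mathcomp Require Import all_boot all_order all_algebra.
From mathcomp Require Import all_classical all_reals all_analysis.
From mathcomp Require Import zify lra.

Set Implicit Arguments.
Unset Strict Implicit.
Unset Printing Implicit Defensive.

Import Order.TTheory GRing.Theory Num.Theory.
Import numFieldNormedType.Exports.

Local Open Scope ring_scope.

(** * Feasible schedules: existence of a minimum and a lower bound on completion times *)

Definition workload (K : realFieldType) (n : nat) (I : instance K n)
    (j : 'I_n) : K :=
  first_time I j + second_time I j.

Section Schedules.
Local Open Scope classical_set_scope.
Variables (R : realType) (n : nat) (I : instance R n).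
Implicit Types (S : 'I_n -> R) (t u : 'I_n * bool) (j : 'I_n).

Definition task_start S t : R :=
  if t.2 then S t.1 + first_time I t.1 + delay_time I t.1 else S t.1.

Definition task_length t : R :=
  if t.2 then second_time I t.1 else first_time I t.1.

Definition task_end S t : R := task_start S t + task_length t.

Definition task_before S t u : bool := task_end S t <= task_start S u.

Lemma task_intervalE S t :
  task_interval I S t = `[task_start S t, task_end S t].
Proof. by case: t => j []. Qed.

(** If both inequalities fail, the midpoint between the larger left end and the smaller right end
    lies in both intervals. *)
Lemma itvoo_disjoint (x y z t : R) : x < y -> z < t ->
  (`]x, y[ `&` `]z, t[ = set0) <-> (y <= z) || (t <= x).
Proof.
move=> xy zt; split=> [dis|h].
  apply/negPn/negP; rewrite negb_or -!ltNge => /andP[zy xt].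
  have lt : Num.max x z < Num.min y t.
    by rewrite gt_max !lt_min xy xt zy zt.
  have [h1 h2] := midf_lt lt.
  have : (`]x, y[ `&` `]z, t[) ((Num.max x z + Num.min y t) / 2).
    move: h1 h2; rewrite gt_max lt_min => /andP[? ?] /andP[? ?].
    by split; rewrite /= in_itv /=; apply/andP.
  by rewrite dis.
rewrite -subset0 => v /= []; rewrite !in_itv /= => /andP[a b] /andP[c d].
by case/orP: h => h; lra.
Qed.

Hypothesis I_valid : valid I.

Lemma task_length_gt0 t : 0 < task_length t.
Proof. by case: t => j []; have [? ? ?] := I_valid j. Qed.

(** Disjoint interiors become non-strict inequalities: a closed condition for the compactness
    argument, and linear arithmetic elsewhere. *)
Lemma feasibleP S : feasible I S <->
  (forall j, 0 <= S j) /\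
  forall t u, t != u -> task_before S t u || task_before S u t.
Proof.
have lt t : task_start S t < task_end S t by rewrite ltrDl task_length_gt0.
split=> -[S_ge0 h]; split=> //.
- move=> t u /eqP tu; apply/(itvoo_disjoint (lt t) (lt u)).
  apply: contra_notP tu => /eqP/set0P tu; apply: h => //.
  by rewrite !task_intervalE !interior_itv_bnd.
- move=> t u _ _; rewrite !task_intervalE !interior_itv_bnd => /set0P tu.
  apply/eqP; apply: contraNT tu => tu; apply/eqP.
  exact/(itvoo_disjoint (lt t) (lt u))/h.
Qed.

Lemma le_completion S j : S j <= completion I S j.
Proof. by have [a_gt0 L_ge0 b_gt0] := I_valid j; rewrite /completion; lra. Qed.

(** This confines every schedule no worse than a given one to a compact box. *)
Lemma le_total_completion S j :
  (forall i, 0 <= S i) -> S j <= total_completion I S.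
Proof.
move=> S_ge0; rewrite /total_completion (bigD1 j) //=.
rewrite (le_trans (le_completion S j)) // lerDl sumr_ge0 // => i _.
exact: le_trans (S_ge0 i) (le_completion S i).
Qed.

Lemma optimal_exists S : feasible I S -> exists Sopt, optimal I Sopt.
Proof.
move=> S_feas.
pose box : set 'rV[R]_n :=
  [set v | forall j, `[0, total_completion I S] (v ord0 j)].
pose sep (v : 'rV[R]_n) :=
  forall t u, t != u ->
    task_before (v ord0) t u || task_before (v ord0) u t.
have coordc j : continuous (fun v : 'rV[R]_n => v ord0 j).
  exact: coord_continuous.
have addc (f : 'rV[R]_n -> R) (g : 'rV[R]_n -> R) :
    continuous f -> continuous g -> continuous (fun v => f v + g v).
  by move=> fc gc v; exact: (@continuousD R R 'rV[R]_n f g v (fc v) (gc v)).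
have addcr (f : 'rV[R]_n -> R) c :
    continuous f -> continuous (fun v => f v + c).
  by move=> fc; apply: addc => //; exact: (@cst_continuous 'rV[R]_n R).
have startc t : continuous (fun v : 'rV[R]_n => task_start (v ord0) t).
  case: t => j []; rewrite /task_start /=; last exact: coordc.
  by do 2!apply/addcr; exact: coordc.
have beforec t u :
    closed [set v : 'rV[R]_n | task_before (v ord0) t u].
  rewrite (_ : mkset _ =
      (fun v : 'rV[R]_n => task_end (v ord0) t - task_start (v ord0) u)
        @^-1` [set x | x <= 0]); last first.
    by apply/seteqP; split=> v /=; rewrite subr_le0.
  apply: preimage_closed; last exact: closed_le.
  move=> v _; apply: addc; first by apply/addcr; exact: startc.
  by move=> w; apply: (@continuousN R R 'rV[R]_n); exact: startc.
have sepc : closed [set v | sep v].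
  rewrite (_ : mkset _ = \bigcap_(p in [set p : ('I_n * bool) * ('I_n * bool) |
      p.1 != p.2]) ([set v : 'rV[R]_n | task_before (v ord0) p.1 p.2] `|`
                    [set v : 'rV[R]_n | task_before (v ord0) p.2 p.1])).
    by apply: closed_bigI => p _; exact: closedU (beforec _ _) (beforec _ _).
  apply/seteqP; split=> v /=.
    by move=> h p /= /h /orP.
  by move=> h t u tu; apply/orP; exact: (h (t, u)).
have K_compact : compact (box `&` [set v | sep v]).
  apply: compact_closedI sepc.
  apply: (@rV_compact R n (fun=> `[0, total_completion I S])) => j.
  exact: segment_compact.
pose vec (S : 'I_n -> R) : 'rV[R]_n := \row_j S j.
have vecE S' : (vec S') ord0 = S' by apply/funext => j; rewrite mxE.
have in_K S' : feasible I S' ->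
    total_completion I S' <= total_completion I S ->
    (box `&` [set v | sep v]) (vec S').
  move=> /feasibleP[ge0 h] le; split; last by rewrite /= /sep vecE.
  move=> j; rewrite vecE /= in_itv /= ge0 /=.
  exact: le_trans (le_total_completion j ge0) le.
have K0 : (box `&` [set v | sep v]) !=set0 by exists (vec S); exact: in_K.
have totalc : {within box `&` [set v | sep v],
    continuous (fun v : 'rV[R]_n => total_completion I (v ord0))}.
  apply: continuous_subspaceT.
  apply: (@continuous_big _ _ _ 0 (fun=> true)); first exact: add_continuous.
  move=> j _.
  by do 3!apply/addcr; exact: coordc.
have [v vK vmin] := EVT_min_rV K0 K_compact totalc.
exists (v ord0); have [vbox vsep] := set_mem vK; split.
  apply/feasibleP; split=> // j.
  by have := vbox j; rewrite /= in_itv /= => /andP[].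
move=> S' S'_feas.
(* A schedule costlier than [S] may leave the box; it is compared through [S], which lies in it. *)
have [le|/ltW lt] := leP (total_completion I S') (total_completion I S).
  by have := vmin _ (mem_set (in_K _ S'_feas le)); rewrite vecE.
apply: le_trans lt.
by have := vmin _ (mem_set (in_K _ S_feas (lexx _))); rewrite vecE.
Qed.

(** Induction on the number of tasks: the task of [A] that ends last is removed, the others end
    before it starts, and its starting time replaces [C]. *)
Lemma sum_length_le (S : 'I_n -> R) (A : {set 'I_n * bool}) (C : R) :
  feasible I S -> 0 <= C -> {in A, forall t, task_end S t <= C} ->
  \sum_(t in A) task_length t <= C.
Proof.
move=> /feasibleP[S_ge0 sep].
have start_ge0 t : 0 <= task_start S t.
  case: t => j []; rewrite /task_start //=.
  by have [? ? ?] := I_valid j; have := S_ge0 j; lra.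
move: C; have [m] := ubnP #|A|; elim: m A => // m IH A /ltnSE cardA C C_ge0 AC.
have [->|[t0 t0A]] := set_0Vmem A; first by rewrite big_set0.
have [t /= tA tmax] := @arg_maxP _ R _ t0 [in A] (task_end S) t0A.
rewrite (big_setD1 t) //= addrC -lerBrDr.
apply: le_trans (_ : task_start S t <= _); last first.
  by rewrite lerBrDr; exact: AC.
apply: IH => // [|u]; first by move: cardA; rewrite (cardsD1 t) tA.
rewrite !inE => /andP[ut uA]; have /orP[//|tu] := sep _ _ ut.
have := tmax u uA; rewrite leNgt => /negP[].
by apply: le_lt_trans tu _; rewrite ltrDl task_length_gt0.
Qed.

Lemma sum_workload_le (S : 'I_n -> R) j : feasible I S ->
  \sum_(i | completion I S i <= completion I S j) workload I i
    <= completion I S j.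
Proof.
move=> S_feas; have [S_ge0 _] := S_feas.
pose A := finset (fun t : 'I_n * bool =>
  completion I S t.1 <= completion I S j).
have C_ge0 : 0 <= completion I S j by rewrite (le_trans _ (le_completion S j)).
suff -> : \sum_(i | completion I S i <= completion I S j) workload I i =
          \sum_(t in A) task_length t.
  apply: (sum_length_le S_feas) => // -[i k].
  rewrite inE /= => ij; apply: le_trans ij.
  case: k => //; rewrite /task_end /task_start /completion /=.
  by have [? ? ?] := I_valid i; rewrite /task_length /=; lra.
rewrite (eq_bigr (fun i => \sum_k task_length (i, k))) => [|i _]; last first.
  by rewrite big_bool /=; exact: addrC.
rewrite pair_big_dep /=; apply: eq_big => [[i k]|[i k] //].
by rewrite !inE andbT.
Qed.

End Schedules.

(** * Back-to-back schedules and the comparison of orders of jobs *)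

Section BackToBack.
Variables (K : realFieldType) (n : nat) (I : instance K n) (S : 'I_n -> K).
Implicit Types (s : seq 'I_n) (j : 'I_n).

Definition duration j : K := first_time I j + delay_time I j + second_time I j.

Lemma completionE j : completion I S j = S j + duration j.
Proof. by rewrite /completion /duration !addrA. Qed.

(** Used in both directions: to evaluate the schedule of the algorithm, and to recognise sums
    obtained in another way as such a schedule. *)
Lemma back_to_backP t s : uniq s ->
  back_to_back I S t s <->
  {in s, forall j,
    S j = t + \sum_(i <- s | (index i s < index j s)%N) duration i}.
Proof.
elim: s t => [|x s IH] t //; rewrite cons_uniq => /andP[xs /IH {}IH].
have idxS i : i \in s -> index i (x :: s) = (index i s).+1.
  by move=> si /=; case: eqP => // xi; rewrite xi si in xs.
have sumx : \sum_(i <- x :: s | (index i (x :: s) < 0)%N) duration i = 0.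
  by rewrite big_pred0.
have sumS j : j \in s ->
    \sum_(i <- x :: s | (index i (x :: s) < index j (x :: s))%N) duration i =
    duration x + \sum_(i <- s | (index i s < index j s)%N) duration i.
  move=> sj; rewrite idxS // big_cons /= eqxx /= big_seq_cond.
  congr (_ + _); rewrite [RHS]big_seq_cond; apply: eq_bigl => i.
  by case: (boolP (i \in s)) => //= si; case: eqP => // xi; rewrite xi si in xs.
split=> [[Sx /IH h] j|h].
  rewrite inE => /predU1P[->|sj].
    by rewrite [index x _]/= eqxx sumx addr0.
  by rewrite sumS // h // completionE Sx [RHS]addrA.
have Sx : S x = t.
  by have := h x (mem_head _ _); rewrite [index x _]/= eqxx sumx addr0.
split=> //; apply/IH => j sj.
by rewrite h ?inE ?sj ?orbT // sumS // completionE Sx [LHS]addrA.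
Qed.

Lemma back_to_back_completion s j :
  perm_eq s (enum 'I_n) -> back_to_back I S 0 s ->
  completion I S j = \sum_(i | (index i s <= index j s)%N) duration i.
Proof.
move=> s_enum; have s_uniq : uniq s by rewrite (perm_uniq s_enum) enum_uniq.
have s_all i : i \in s by rewrite (perm_mem s_enum) mem_enum.
move/(back_to_backP _ s_uniq) => h.
rewrite completionE h // add0r (perm_big _ s_enum) big_enum_cond /=.
rewrite [RHS](bigD1 j) //= addrC; congr (_ + _).
apply: eq_bigl => i; rewrite ltn_neqAle andbC; congr (_ && ~~ _).
by apply/eqP/eqP => [/(index_inj i (s_all i) (s_all j))|->].
Qed.

End BackToBack.

(** The sums are symmetrised, so that each pair of jobs can be compared alone. For [i != j],
    antisymmetry lets [r] count at most one of [q i] and [q j], and then the smaller one; totality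
    makes [r'] count at least one. *)
Lemma sum_priority_le (R : realFieldType) (n : nat) (q : 'I_n -> R)
    (r r' : rel 'I_n) :
  (forall i, 0 <= q i) -> antisymmetric r -> total r' ->
  (forall i j, r i j -> q i <= q j) ->
  \sum_j \sum_(i | r i j) q i <= \sum_j \sum_(i | r' i j) q i.
Proof.
move=> q_ge0 r_anti r'_total r_q.
have sym (e : rel 'I_n) : (\sum_j \sum_(i | e i j) q i) *+ 2 =
    \sum_j \sum_i ((if e i j then q i else 0) + (if e j i then q j else 0)).
  under [RHS]eq_bigr do rewrite big_split /=.
  rewrite big_split /= mulr2n; congr (_ + _).
    by apply: eq_bigr => j _; rewrite big_mkcond.
  rewrite exchange_big /=; apply: eq_bigr => i _.
  by rewrite big_mkcond.
rewrite -(ler_pMn2r (isT : (0 < 2)%N)) !sym.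
apply: ler_sum => j _; apply: ler_sum => i _.
have [-> |ij] := eqVneq i j.
  by have := r'_total j j; rewrite orbb => ->; case: ifP => _; apply: lerD.
have := r'_total i j; have := r_q i j; have := r_q j i.
have := r_anti i j; have := q_ge0 i; have := q_ge0 j.
case: (r i j) (r j i) (r' i j) (r' j i) => [] [] [] [] //= ? ? h qji qij _.
all: try (by move: ij; rewrite h // eqxx).
all: try (have {}qij := qij isT); try (have {}qji := qji isT); lra.
Qed.

(** * Feasibility and the factor 2 *)

Section Approximation.
Variables (R : realType) (n : nat) (I : instance R n).
Hypotheses (I_valid : valid I) (I_pp : delay_eq_first I).

Lemma duration_ge0 j : 0 <= duration I j.
Proof. by have [? ? ?] := I_valid j; rewrite /duration; lra. Qed.

Lemma back_to_back_feasible S s :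
  perm_eq s (enum 'I_n) -> back_to_back I S 0 s -> feasible I S.
Proof.
move=> s_enum S_s.
(* Adding the duration of [j] to both sides leaves two sums over jobs up to a position; the one for
   [i] does not contain [j]. *)
have Sle i j : (index i s < index j s)%N -> completion I S i <= S j.
  move=> ij; rewrite -(lerD2r (duration I j)) -completionE.
  rewrite !(back_to_back_completion _ s_enum S_s).
  rewrite [leRHS](bigD1 j) //= [leLHS]addrC lerD2l.
  rewrite big_mkcond [leRHS]big_mkcond /=.
  apply: ler_sum => k _; case: ifP => ki.
    rewrite (leq_trans ki (ltnW ij)); case: eqP => // kj.
    by rewrite kj leqNgt ij in ki.
  by case: ifP => _ //; exact: duration_ge0.
apply/feasibleP => //; split=> [j|].
  rewrite -(lerD2r (duration I j)) -completionE add0r.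
  rewrite (back_to_back_completion _ s_enum S_s) (bigD1 j) //= lerDl.
  by apply: sumr_ge0 => i _; exact: duration_ge0.
have s_all i : i \in s by rewrite (perm_mem s_enum) mem_enum.
move=> [i k] [j l]; have [<- {j}|ij] := eqVneq i j.
  have [? ? ?] := I_valid i.
  rewrite /task_before /task_end /task_start /task_length.
  by case: k l => [] []; rewrite ?eqxx //= => _; apply/orP; [right|left]; lra.
move=> _; wlog lt : i k j l ij / (index i s < index j s)%N.
  move=> wl.
  have [|lt|/(index_inj i (s_all i) (s_all j)) eq] :=
    ltngtP (index i s) (index j s).
  - exact: wl.
  - by rewrite orbC; apply: wl => //; rewrite eq_sym.
  - by rewrite eq // eqxx in ij.
have := Sle i j lt; have [? ? ?] := I_valid i; have [? ? ?] := I_valid j.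
rewrite /task_before /task_end /task_start /task_length /completion.
by case: k l => [] [] /= *; apply/orP; left; lra.
Qed.

Lemma modified_algorithm_3_feasible S :
  modified_algorithm_3 I S -> feasible I S.
Proof. by move=> [s [s_enum _]]; exact: back_to_back_feasible. Qed.

Lemma modified_algorithm_3_ratio S S' :
  modified_algorithm_3 I S -> feasible I S' ->
  total_completion I S <= 2 * total_completion I S'.
Proof.
move=> [s [s_enum s_sorted S_s]] S'_feas.
have s_all i : i \in s by rewrite (perm_mem s_enum) mem_enum.
have q_ge0 i : 0 <= workload I i.
  by have [? ? ?] := I_valid i; rewrite /workload; lra.
apply: le_trans (_ : 2 * \sum_j \sum_(i | (index i s <= index j s)%N)
                           workload I i <= _).
  rewrite /total_completion mulr_sumr; apply: ler_sum => j _.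
  rewrite (back_to_back_completion _ s_enum S_s) mulr_sumr.
  apply: ler_sum => i _; have [? ? ?] := I_valid i.
  by rewrite /duration /workload I_pp; lra.
(* Position in [s] is antisymmetric and respects the workload, and the order of completion times in
   [S'] is total, as [sum_priority_le] requires. *)
rewrite ler_pM2l //; apply: le_trans (_ : \sum_j \sum_(i |
    completion I S' i <= completion I S' j) workload I i <= _).
  apply: (sum_priority_le (r := fun i j => (index i s <= index j s)%N)
    (r' := fun i j => completion I S' i <= completion I S' j)) => //.
  - by move=> i j /= /anti_leq /(index_inj i (s_all i) (s_all j)) ->.
  - by move=> i j; exact: le_total.
  - move=> i j; apply: (sorted_leq_index _ _ s_sorted) => //.
    by move=> y x z; exact: le_trans.
by apply: ler_sum => j _; exact: sum_workload_le.
Qed.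

End Approximation.

(** * The lexicographic order of jobs, and the transfer from rationals to reals *)

Section Priority.
Variables (K : realFieldType) (n : nat) (I : instance K n).
Implicit Types i j : 'I_n.

(** The strict lexicographic order of workload and index, phrased with [<=] on data alone since this
    is the test that [IfD] offers. *)
Definition precedes i j : bool :=
  (workload I i <= workload I j) &&
  ((workload I j <= workload I i) ==> (i < j)%N).

Lemma priority_schedule (S : 'I_n -> K) :
  (forall j, S j = \sum_(i | precedes i j) duration I i) ->
  modified_algorithm_3 I S.
Proof.
move=> S_sum; pose le i j := workload I i <= workload I j.
have le_total : total le by move=> i j; exact: le_total.
pose s := sort le (enum 'I_n).
have s_enum : perm_eq s (enum 'I_n) by rewrite perm_sort.
have s_uniq : uniq s by rewrite (perm_uniq s_enum) enum_uniq.
have s_all i : i \in s by rewrite (perm_mem s_enum) mem_enum.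
have precedes_trans : transitive precedes.
  move=> j i k /andP[ij /implyP ji] /andP[jk /implyP kj].
  rewrite /precedes (le_trans ij jk); apply/implyP => ki.
  exact: ltn_trans (ji (le_trans jk ki)) (kj (le_trans ki ij)).
(* Stability matters: jobs of equal workload keep the increasing index order of the enumeration. *)
have s_sorted : sorted precedes s.
  apply: (sort_stable (leT' := fun i j : 'I_n => (i < j)%N)) => //.
    by move=> j i k; exact: ltn_trans.
  by have := iota_ltn_sorted 0 n; rewrite -val_enum_ord sorted_map.
exists s; split=> //; first exact: sort_sorted.
apply/(back_to_backP I S 0 s_uniq) => j _.
rewrite S_sum add0r (perm_big _ s_enum) big_enum_cond /=.
apply: eq_bigl => i; apply/idP/idP => [|ij]; last first.
  exact: (sorted_ltn_index precedes_trans s_sorted).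
(* Otherwise [i = j], or [j] also precedes [i]; both contradict the strict order on indices. *)
move=> /andP[ij /implyP ji]; rewrite ltnNge; apply/negP.
rewrite leq_eqVlt => /predU1P[/(index_inj i (s_all j) (s_all i)) eq_ji|].
  by have := ji; rewrite eq_ji lexx ltnn => /(_ isT).
move/(sorted_ltn_index precedes_trans s_sorted _ _ (s_all j) (s_all i)).
move=> /andP[le_ji /implyP /(_ ij) lt_ji].
by have := ltn_trans lt_ji (ji le_ji); rewrite ltnn.
Qed.

End Priority.

(** [ratr] preserves sums and order. It carries the rational output, for which bit cost makes sense,
    to the reals, where feasibility and optimality are defined. *)
Lemma modified_algorithm_3_ratr (R : realFieldType) (n : nat)
    (I : instance rat n) (S : 'I_n -> rat) :
  modified_algorithm_3 I S ->
  modified_algorithm_3 (map_instance (@ratr R) I) (fun j => ratr (S j)).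
Proof.
move=> [s [s_enum s_sorted S_s]]; exists s; split=> //.
  apply: sub_sorted s_sorted => i j /=.
  by rewrite -!rmorphD ler_rat.
have -> : 0 = ratr 0 :> R by rewrite rmorph0.
elim: s 0 {s_enum s_sorted} S_s => //= j s IH t [-> /IH].
by rewrite /completion /= -!rmorphD.
Qed.

(** * A cost calculus for programs *)

Lemma bitlen_le m k : (m <= k)%N -> (bitlen m <= k.+1)%N.
Proof.
move=> mk; rewrite /bitlen ltnS (leq_trans _ mk) //.
have [->|m_gt0] := posnP m; first by rewrite trunc_log0.
exact: leq_trans (ltnW (ltn_expl _ _)) (trunc_logP _ m_gt0).
Qed.

Section Halting.
Variables (K : realFieldType) (w : K -> nat).
Implicit Types (c : cmd) (st : state K) (Q : state K -> Prop).

(** A Hoare triple for total correctness, with a bound rather than an exact value for the cost. *)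
Definition halts c st (T : nat) Q : Prop :=
  exists st' T', [/\ exec w c st T' st', (T' <= T)%N & Q st'].

Lemma halts_seq c c' st T T' Q Q' :
  halts c st T Q -> (forall st', Q st' -> halts c' st' T' Q') ->
  halts (Seq c c') st (T + T') Q'.
Proof.
move=> [st1 [t1 [e1 le1 Q1]]] /(_ _ Q1)[st2 [t2 [e2 le2 Q2]]].
exists st2, (t1 + t2)%N; split=> //; last exact: leq_add.
exact: exec_Seq e1 e2.
Qed.

Lemma halts_le c st T T' Q : (T <= T')%N -> halts c st T Q -> halts c st T' Q.
Proof.
move=> TT' [st' [t [e le Qst']]]; exists st', t; split=> //.
exact: leq_trans le TT'.
Qed.

Lemma halts_imp c st T Q Q' :
  (forall st', Q st' -> Q' st') -> halts c st T Q -> halts c st T Q'.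
Proof. by move=> QQ' [st' [t [e le /QQ' Q'st']]]; exists st', t. Qed.

Lemma halts_skip st Q : Q st -> halts Skip st 1 Q.
Proof. by move=> Qst; exists st, 1%N; split=> //; exact: exec_Skip. Qed.

Lemma halts_IfI x y c c' st T Q :
  halts (if (reg st x < reg st y)%N then c else c') st T Q ->
  halts (IfI x y c c') st (1 + bitlen (reg st x) + bitlen (reg st y) + T) Q.
Proof.
move=> [st' [t [e le Qst']]]; eexists st', _.
by split; [exact: exec_IfI e|rewrite leq_add2l|].
Qed.

Lemma halts_IfD A x B y c c' st T Q :
  halts (if get_arr st A x <= get_arr st B y then c else c') st T Q ->
  halts (IfD A x B y c c') st
    (1 + bitlen (reg st x) + bitlen (reg st y)
       + w (get_arr st A x) + w (get_arr st B y) + T) Q.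
Proof.
move=> [st' [t [e le Qst']]]; eexists st', _.
by split; [exact: exec_IfD e|rewrite leq_add2l|].
Qed.

(** [B] pays for one test of the guard: [m] times before an iteration and once for the final
    failure. *)
Lemma halts_while x y c B T (inv : nat -> state K -> Prop) m :
  (forall k st, (k <= m)%N -> inv k st ->
     [/\ reg st x = k, reg st y = m & (1 + bitlen k + bitlen m <= B)%N]) ->
  (forall k st, (k < m)%N -> inv k st -> halts c st T (inv k.+1)) ->
  forall st, inv 0 st -> halts (While x y c) st (m * (B + T) + B) (inv m).
Proof.
move=> reg_inv step st inv_st.
suff loop d k st' : (k + d)%N = m -> inv k st' ->
    halts (While x y c) st' (d * (B + T) + B) (inv m).
  exact: loop inv_st.
elim: d k st' {st inv_st} => [|d IH] k st km inv_st.
  have [||rx ry le] := reg_inv k st => //; first by lia.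
  have {}km : k = m by lia.
  exists st, (1 + bitlen (reg st x) + bitlen (reg st y))%N; split.
  - by apply: exec_While_stop; rewrite rx ry km.
  - by rewrite rx ry; lia.
  - by rewrite -[in inv m]km.
have [||rx ry le] := reg_inv k st => //; first by lia.
have [|st1 [t1 [e1 le1 inv1]]] := step k st _ inv_st; first by lia.
have [|st2 [t2 [e2 le2 inv2]]] := IH _ _ _ inv1; first by lia.
exists st2, (1 + bitlen (reg st x) + bitlen (reg st y) + t1 + t2)%N; split=> //.
- by apply: exec_While_step e1 e2; rewrite rx ry; lia.
- by rewrite rx ry mulSn; lia.
Qed.

End Halting.

(** * The program, its invariant and its cost *)

(* Registers: 0 holds n, 1 the job j whose starting time is computed, 2 the job
   i whose duration is possibly added to it, 3 the constant 1. *)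
Definition add_duration : cmd :=
  Seq (DAdd 3 1 3 1 0 2) (Seq (DAdd 3 1 3 1 1 2) (DAdd 3 1 3 1 2 2)).

Definition compute_key (r : nat) : cmd := DAdd 4 r 0 r 2 r.

Definition inner_body : cmd :=
  Seq (Seq (compute_key 2) (compute_key 1))
    (Seq (IfI 2 1 (IfD 4 2 4 1 add_duration Skip)
                  (IfD 4 1 4 2 Skip add_duration))
         (IAdd 2 2 3)).

Definition outer_body : cmd :=
  Seq (IConst 2 0) (Seq (While 2 0 inner_body) (IAdd 1 1 3)).

Definition schedule_cmd : cmd := Seq (IConst 3 1) (While 1 0 outer_body).

(* The bit size of x + y may be as large as twice those of x and y together, so
   the weights of partial sums are controlled through a height H that is
   subadditive up to 1. *)
Section Program.
Variables (K : realFieldType) (w H : K -> nat) (n : nat) (I : instance K n).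
Hypotheses (H0 : (H 0 <= 1)%N)
  (HD : forall x y, (H (x + y) <= (H x + H y).+1)%N)
  (wH : forall x, (w x <= 2 * H x)%N).

Let a := input_array (first_time I).
Let L := input_array (delay_time I).
Let b := input_array (second_time I).
Let dur i : K := a i + L i + b i.
Let key i : K := a i + b i.
Let prec (i j : nat) : bool :=
  (key i <= key j) && ((key j <= key i) ==> (i < j)%N).
(** The intended content of cell [j] of array 3 once the inner loop has examined the jobs below
    [i]. *)
Let start (j i : nat) : K := \sum_(0 <= k < i | prec k j) dur k.

(** The 3 pays for three additions: two inside [dur i] and one onto the partial sum. The 1 in [M]
    comes from [H0]. In [D], three indices cost at most [n.+1] each and two data at most [2 * M]
    each. *)
Let h i := (H (a i) + H (L i) + H (b i) + 3)%N.
Let M := (1 + \sum_(0 <= k < n) h k)%N.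
Let D := (1 + 3 * n.+1 + 4 * M)%N.

Let h_le i : (i < n)%N -> (h i <= M)%N.
Proof.
move=> i_n.
by rewrite /M (bigD1_seq i) ?mem_index_iota ?iota_uniq //= addnCA leq_addr.
Qed.

Let H_dur i : (H (dur i) < h i)%N.
Proof.
have := HD (a i) (L i); have := HD (a i + L i) (b i).
by rewrite -/(dur i) /h; lia.
Qed.

Let H_start j i :
  (H (start j i) <= 1 + \sum_(0 <= k < i) h k)%N.
Proof.
elim: i => [|i IH]; first by rewrite /start !big_geq // addn0.
rewrite /start big_mkcond big_nat_recr //= -big_mkcond -/(start j i).
rewrite big_nat_recr //=; case: ifP => _; last by rewrite addr0; lia.
by apply: leq_trans (HD _ _) _; have := H_dur i; lia.
Qed.

(** This leaves room to add the duration of job [i] in three separate instructions while all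
    intermediate heights stay below [M]. *)
Let H_start_step j i : (i < n)%N -> (H (start j i) + h i <= M)%N.
Proof.
move=> i_n; have := H_start j i.
by rewrite /M (big_cat_nat (leq0n i) (ltnW i_n)) /= (big_ltn i_n); lia.
Qed.

(** Cells of array 3 above [j] are still zero, so each sum starts from 0. Array 4 is left free, as
    the keys are recomputed in every inner iteration. *)
Let inv (j i : nat) (x : K) (st : state K) : Prop :=
  [/\ [/\ reg st 0 = n, reg st 1 = j, reg st 2 = i & reg st 3 = 1%N],
      [/\ arr st 0 =1 a, arr st 1 =1 L & arr st 2 =1 b]
    & forall k, arr st 3 k =
        if (k < j)%N then start k n else if k == j then x else 0].

Let input (A : nat) : nat -> K :=
  match A with 0 => a | 1 => L | _ => b end.

Let inv_input A j i x st : (A < 3)%N -> inv j i x st -> arr st A =1 input A.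
Proof. by case: A => [|[|[|]]] // _ [_ []]. Qed.

Let bitlen_lt k : (k < n)%N -> (bitlen k <= n.+1)%N.
Proof. by move=> k_n; apply: bitlen_le; exact: ltnW. Qed.

Let add_input_halts A j i x st : (A < 3)%N -> (j < n)%N -> (i < n)%N ->
  (H x <= M)%N -> inv j i x st ->
  halts w (DAdd 3 1 3 1 A 2) st D (inv j i (x + input A i)).
Proof.
move=> A3 j_n i_n xM inv_st; have inA := inv_input A3 inv_st.
case: inv_st => [[r0 r1 r2 r3] [a0 a1 a2] a3].
have bj := bitlen_lt j_n; have bi := bitlen_lt i_n.
have xj : arr st 3 j = x by rewrite a3 ltnn eqxx.
have HA : (H (input A i) <= M)%N.
  have := h_le i_n; rewrite /h.
  by case: A A3 {inA} => [|[|[|]]] //= _; lia.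
eexists _, _; split; first exact: exec_DAdd.
  rewrite /get_arr r1 r2 xj inA; have := wH x; have := wH (input A i).
  by rewrite /D; lia.
split=> //= k; rewrite /get_arr r1 r2 xj inA /=.
by have [->|kj] := eqVneq k j; [rewrite ltnn|rewrite a3 (negbTE kj)].
Qed.

Let add_duration_halts j i x st : (j < n)%N -> (i < n)%N ->
  (H x + h i <= M)%N -> inv j i x st ->
  halts w add_duration st (D + (D + D)) (inv j i (x + dur i)).
Proof.
move=> j_n i_n; rewrite /h => xM inv_st.
have Hxa := HD x (a i); have HxaL := HD (x + a i) (L i).
rewrite /dur !addrA.
apply: halts_seq => [|st1 inv1].
  by apply: (add_input_halts (A := 0)) inv_st => //; lia.
apply: halts_seq => [|st2].
  by apply: (add_input_halts (A := 1)) inv1 => //=; lia.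
by move=> inv2; apply: (add_input_halts (A := 2)) inv2 => //=; lia.
Qed.

Let H_key i : (i < n)%N -> (H (key i) <= M)%N.
Proof.
move=> /h_le; rewrite /h; have := HD (a i) (b i); rewrite -/(key i); lia.
Qed.

Let compute_key_halts r j i x st : (r == 1) || (r == 2) ->
  (j < n)%N -> (i < n)%N -> inv j i x st ->
  halts w (compute_key r) st D (fun st' =>
    inv j i x st' /\
    arr st' 4 = fun k => if k == reg st r then key k else arr st 4 k).
Proof.
move=> r12 j_n i_n [[r0 r1 r2 r3] [a0 a1 a2] a3].
have rn : (reg st r < n)%N by case/orP: r12 => /eqP ->; rewrite ?r1 ?r2.
have br := bitlen_lt rn.
eexists _, _; split; first exact: exec_DAdd.
  rewrite /get_arr a0 a2; have := h_le rn; rewrite /h.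
  have := wH (a (reg st r)); have := wH (b (reg st r)).
  by rewrite /D; lia.
split; first by split.
apply/funext => k /=; rewrite /get_arr a0 a2.
by case: eqP => // ->.
Qed.

Let start_recr j i :
  start j i.+1 = if prec i j then start j i + dur i else start j i.
Proof.
rewrite /start big_mkcond big_nat_recr //= -big_mkcond.
by case: ifP; rewrite ?addr0.
Qed.

Let inner_body_halts j i st : (j < n)%N -> (i < n)%N ->
  inv j i (start j i) st ->
  halts w inner_body st (8 * D) (inv j i.+1 (start j i.+1)).
Proof.
move=> j_n i_n inv_st.
have bj := bitlen_lt j_n; have bi := bitlen_lt i_n.
have wi := wH (key i); have wj := wH (key j).
have ki := H_key i_n; have kj := H_key j_n.
(* At most eight instructions are charged: two keys, two tests, three additions and the
   increment. *)
rewrite (_ : 8 * D = (D + D) + ((D + (D + (D + (D + D)))) + D))%N; last lia.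
apply: (halts_seq (Q := fun st' => [/\ inv j i (start j i) st',
    arr st' 4 i = key i & arr st' 4 j = key j])).
  apply: halts_seq; first exact: compute_key_halts inv_st.
  move=> st1 [inv1 k1].
  have := compute_key_halts (r := 1) isT j_n i_n inv1.
  apply: halts_imp => st2 [inv2 k2]; split=> //; rewrite k2 k1.
    (* If [i = j], the second write puts the same key into the same cell. *)
    case: inv_st inv1 => [[_ _ -> _] _ _] [[_ -> _ _] _ _].
    by rewrite eqxx; case: ifP.
  by case: inv1 => [[_ -> _ _] _ _]; rewrite eqxx.
move=> st1 [inv1 ki1 kj1].
apply: (halts_seq (Q := inv j i (start j i.+1))); last first.
  move=> st2 [[r0 r1 r2 r3] as2 a3].
  eexists _, _; split; first exact: exec_IAdd.
    by rewrite r2 r3 /D; have := bitlen_le (leqnn 1); lia.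
  by split=> //=; split=> //; rewrite r2 r3 addn1.
have add_halts := add_duration_halts j_n i_n (H_start_step j i_n) inv1.
have skip_halts : halts w Skip st1 (D + (D + D)) (inv j i (start j i)).
  by apply: halts_le (halts_skip _ inv1); rewrite /D; lia.
have [[_ r1 r2 _] _ _] := inv1.
apply: halts_le (halts_IfI (T := D + (D + (D + D))) _).
  by rewrite r1 r2 /D; lia.
rewrite r1 r2.
(* When [i < j] a tie counts, so [key i <= key j] decides; otherwise a strict inequality is
   required, tested as the failure of [key j <= key i]. *)
case: ifP => ij; apply: halts_le (halts_IfD (T := D + (D + D)) _).
- by rewrite /get_arr r1 r2 ki1 kj1 /D; lia.
- rewrite /get_arr r1 r2 ki1 kj1 start_recr /prec ij implybT andbT.
  by case: ifP.
- by rewrite /get_arr r1 r2 ki1 kj1 /D; lia.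
- rewrite /get_arr r1 r2 ki1 kj1 start_recr /prec ij implybF.
  case: (leP (key j) (key i)) => [|/ltW ->]; last by [].
  by rewrite andbF.
Qed.

(** The content of register 2 is quantified away, as the body begins by resetting it. *)
Let outer_body_halts j st : (j < n)%N -> (exists i, inv j i 0 st) ->
  halts w outer_body st (D + ((n * (D + 8 * D) + D) + D))
    (fun st' => exists i, inv j.+1 i 0 st').
Proof.
move=> j_n [i inv_st].
apply: (halts_seq (Q := inv j 0 (start j 0))).
  eexists _, _; split; first exact: exec_IConst.
    by rewrite /D; have := bitlen_le (leqnn 0); lia.
  case: inv_st => [[r0 r1 r2 r3] as_ a3]; split=> //= k.
  by rewrite a3 [start j 0]big_geq.
move=> st1 inv1; apply: (halts_seq (Q := inv j n (start j n))).
  apply: (halts_while (inv := fun i => inv j i (start j i))) inv1.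
    move=> k st2 kn [[r0 _ r2 _] _ _]; split=> //.
    by have := bitlen_le kn; have := bitlen_le (leqnn n); rewrite /D; lia.
  by move=> k st2 kn inv2; exact: inner_body_halts.
move=> st2 [[r0 r1 r2 r3] as2 a3]; eexists _, _; split; first exact: exec_IAdd.
  by rewrite r1 r3 /D; have := bitlen_le (leqnn 1); have := bitlen_lt j_n; lia.
exists n; split=> //=; first by split=> //; rewrite r1 r3 addn1.
(* Cell [j] is now final, and cell [j.+1] still holds the default 0. *)
by move=> k; rewrite a3 if_same ltnS; case: (ltngtP k j) => // ->.
Qed.

(* The first factor bounds the number of instructions, the second one the cost
   of each of them, which involves at most three indices and two data. *)
Lemma schedule_cmd_halts :
  halts w schedule_cmd (input_state I)
    ((9 * n * n + 4 * n + 2) * (1 + 3 * n.+1 +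
       4 * (1 + \sum_(j < n) (H (first_time I j) + H (delay_time I j)
                              + H (second_time I j) + 3))))
    (fun st => forall j : 'I_n,
       arr st 3 j = \sum_(i | precedes I i j) duration I i).
Proof.
have inE_ (f : 'I_n -> K) (i : 'I_n) : input_array f i = f i.
  by rewrite /input_array valK.
have -> : (1 + \sum_(j < n) (H (first_time I j) + H (delay_time I j)
                              + H (second_time I j) + 3))%N = M.
  by rewrite /M big_mkord; congr (_ + _)%N; apply: eq_bigr => j _;
    rewrite /h /a /L /b !inE_.
(* With its guard, an inner iteration costs [9 * D] and an outer one [(9 * n + 4) * D]; [2 * D]
   remains for the initialisation and the last test. *)
rewrite -/D (_ : (_ * D)%N =
  D + (n * (D + (D + ((n * (D + 8 * D) + D) + D))) + D))%N; last lia.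
apply: (halts_seq (Q := fun st => exists i, inv 0 i 0 st)).
  eexists _, _; split; first exact: exec_IConst.
    by rewrite /D; have := bitlen_le (leqnn 1); lia.
  by exists 0%N; split=> //= k; case: ifP.
move=> st1 inv1.
have : halts w (While 1 0 outer_body) st1
    (n * (D + (D + ((n * (D + 8 * D) + D) + D))) + D)
    (fun st => exists i, inv n i 0 st).
  apply: (halts_while (inv := fun j st => exists i, inv j i 0 st)) inv1.
    move=> k st2 kn [i [[r0 r1 _ _] _ _]]; split=> //.
    by have := bitlen_le kn; have := bitlen_le (leqnn n); rewrite /D; lia.
  by move=> k st2 kn inv2; exact: outer_body_halts.
apply: halts_imp => st [i [_ _ a3]] j; rewrite a3 ltn_ord /start big_mkord.
apply: eq_big => [k|k _]; rewrite /prec /key /dur /a /L /b !inE_ //.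
Qed.

End Program.

(** * Bit sizes of rational sums *)

Lemma ltn_exp_bitlen m : (m < 2 ^ bitlen m)%N.
Proof. exact: trunc_log_ltn. Qed.

(** The exponent is a successor because [bitlen 0] is 1. *)
Lemma bitlen_leq_exp m k : (m < 2 ^ k.+1)%N -> (bitlen m <= k.+1)%N.
Proof.
have [->|m_gt0] := posnP m; first by rewrite /bitlen trunc_log0.
move=> lt; rewrite -(ltn_exp2l _ _ (isT : 1 < 2)%N) (leq_ltn_trans _ lt) //.
exact: trunc_logP.
Qed.

(** Plays the role of [H]: a cross-multiplied numerator or denominator has at most the heights of
    both arguments, plus 1, as its bit length. *)
Definition height (x : rat) : nat :=
  maxn (bitlen `|numq x|) (bitlen `|denq x|).

(** The bounds hold for the cross-multiplied fraction, and reduction to lowest terms only divides by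
    a common factor [k]. *)
Lemma num_den_addq_leq (x y : rat) :
  (`|numq (x + y)| <= `|numq x| * `|denq y| + `|numq y| * `|denq x|)%N /\
  (`|denq (x + y)| <= `|denq x| * `|denq y|)%N.
Proof.
have -> : x + y =
    (numq x * denq y + numq y * denq x)%:Q / (denq x * denq y)%:Q.
  rewrite -{1}(divq_num_den x) -{1}(divq_num_den y).
  rewrite addf_div ?intr_eq0 ?denq_neq0 //.
  by rewrite -!intrM -intrD.
set p := numq x * _ + _; set d := denq x * _.
have le_p : (`|p| <= `|numq x| * `|denq y| + `|numq y| * `|denq x|)%N.
  by rewrite -!abszM; lia.
have le_d : (`|d| = `|denq x| * `|denq y|)%N by rewrite abszM.
have d_neq0 : d != 0 by rewrite mulf_neq0 ?denq_neq0.
rewrite -le_d; move: le_p d_neq0 {le_d}.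
case: divqP => [|k z k_neq0]; first by rewrite eqxx.
rewrite !abszM => le_p _; have k_gt0 : (0 < `|k|)%N by rewrite absz_gt0.
by split; [apply: leq_trans le_p|]; exact: leq_pmull.
Qed.

(** The numerator is bounded by two products, each below [2 ^ (height x + height y)]; their sum
    takes one bit more. *)
Lemma heightD (x y : rat) : (height (x + y) <= (height x + height y).+1)%N.
Proof.
have [le_num le_den] := num_den_addq_leq x y.
have lt q : (`|numq q| < 2 ^ height q)%N /\ (`|denq q| < 2 ^ height q)%N.
  by split; apply: leq_trans (ltn_exp_bitlen _) _;
    rewrite leq_exp2l // /height ?leq_maxl ?leq_maxr.
have [nx dx] := lt x; have [ny dy] := lt y.
have nxdy := ltn_mul nx dy; have nydx := ltn_mul ny dx.
have dxdy := ltn_mul dx dy.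
rewrite geq_max; apply/andP; split; apply: bitlen_leq_exp; rewrite expnS expnD.
  apply: leq_ltn_trans le_num (leq_trans (leq_add nxdy (ltnW nydx)) _).
  by rewrite (mulnC (2 ^ height y)%N) addnn mul2n.
apply: leq_ltn_trans le_den (leq_trans dxdy _).
by rewrite leq_pmull.
Qed.

Lemma bitsize_le_height x : (bitsize x <= 2 * height x)%N.
Proof. by rewrite mul2n -addnn leq_add // ?leq_maxl ?leq_maxr. Qed.

Lemma height_le_bitsize x : (height x <= bitsize x)%N.
Proof. by rewrite geq_max leq_addr leq_addl. Qed.

Lemma bitsize_ge2 x : (2 <= bitsize x)%N.
Proof. by rewrite /bitsize /bitlen addSn addnS. Qed.

(** * The polynomial bound and the conclusion *)

Definition cost_bound : {poly nat} :=
  (9%N%:P * 'X * 'X + 4%N%:P * 'X + 2%N%:P) * (15%N%:P * 'X + 8%N%:P).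

(** Substituting [N] for [n] and [3 * N] for [s] turns the second factor into [15 * N + 8]. *)
Lemma cost_bound_geq n s N : (n <= N)%N -> (s <= 3 * N)%N ->
  ((9 * n * n + 4 * n + 2) * (1 + 3 * n.+1 + 4 * (1 + s)) <= cost_bound.[N])%N.
Proof.
move=> nN sN.
have -> : cost_bound.[N] = ((9 * N * N + 4 * N + 2) * (15 * N + 8))%N.
  by rewrite /cost_bound !(hornerD, hornerM, hornerC, hornerX).
apply: leq_mul; last lia.
by rewrite !leq_add // ?leq_mul.
Qed.

Theorem theorem11 :
  (exists (prog : cmd) (P : {poly nat}),
     (forall (R : realType) (n : nat) (I : instance R n),
        valid I -> delay_eq_first I ->
        exists (S : 'I_n -> R) (T : nat),
          [/\ computes (@unit_weight R) prog I S T,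
              (T <= P.[n])%N
            & modified_algorithm_3 I S]) /\
     (forall (n : nat) (I : instance rat n),
        valid I -> delay_eq_first I ->
        exists (S : 'I_n -> rat) (T : nat),
          [/\ computes bitsize prog I S T,
              (T <= P.[input_size I])%N
            & forall R : realType,
                modified_algorithm_3 (map_instance (@ratr R) I)
                  (fun j => ratr (S j))])) /\
  (forall (R : realType) (n : nat) (I : instance R n),
     valid I -> delay_eq_first I ->
     forall S : 'I_n -> R, modified_algorithm_3 I S ->
       feasible I S /\
       exists2 Sopt : 'I_n -> R, optimal I Sopt &
         total_completion I S <= 2 * total_completion I Sopt).
Proof.
split; last first.
  move=> R n I I_valid I_pp S S_alg.
  have S_feas := modified_algorithm_3_feasible I_valid S_alg.
  split=> //; have [Sopt Sopt_opt] := optimal_exists I_valid S_feas.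
  exists Sopt => //; have [Sopt_feas _] := Sopt_opt.
  exact: modified_algorithm_3_ratio.
exists schedule_cmd, cost_bound; split=> [R n I _ _|n I _ _].
  (* Under unit cost data weigh nothing, so the zero height serves. *)
  have [//|//|//|st [T [e le out]]] :=
    @schedule_cmd_halts R (@unit_weight R) (fun=> 0%N) n I.
  exists (fun j => arr st 3 j), T; split.
  - by exists st.
  - apply: leq_trans le (cost_bound_geq (leqnn n) _).
    by rewrite sum_nat_const card_ord; lia.
  - exact: priority_schedule.
have [//|||st [T [e le out]]] := @schedule_cmd_halts rat bitsize height n I.
- exact: heightD.
- exact: bitsize_le_height.
(* Every number takes at least two bits, so the input size dominates [n]. *)
have n_le : (n <= input_size I)%N.
  rewrite -[leqLHS]card_ord -sum1_card; apply: leq_sum => j _.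
  by have := bitsize_ge2 (first_time I j); lia.
exists (fun j => arr st 3 j), T; split.
- by exists st.
- apply: leq_trans le (cost_bound_geq n_le _).
  (* The extra 3 per job is absorbed by tripling a bit size that is at least 2. *)
  rewrite /input_size big_distrr; apply: leq_sum => j _ /=.
  have := height_le_bitsize (first_time I j).
  have := height_le_bitsize (delay_time I j).
  have := height_le_bitsize (second_time I j).
  by have := bitsize_ge2 (first_time I j); lia.
- by move=> R; apply/modified_algorithm_3_ratr/priority_schedule.
Qed.
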